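(* Let $d$ be a positive odd integer divisible by $3$, let $a$ be an integer with $a\equiv 1 \pmod{12}$, and let $b=2^d a-3$. Then the equation $$ax^d-y^2-z^2+xyz-b=0$$ has no solution $(x,y,z)\in\mathbb{Z}^3$. *)

(* Defs.v *)
From mathcomp Require Export all_boot all_order all_algebra.

(* Main.v *)
(** Modulo 12 the equation forces either [x = 9], or [x = 5] with [y], [z] even and
    congruent modulo 3. Putting [Q = (x^d - 2^d) / (x - 2)], it factors as
    [(y - z)^2 - 3 = (x - 2) (y z + a Q)], and no divisor of [u^2 - 3] is
    congruent to 5 or 7 modulo 12. In the first case [x - 2] is 7 modulo 12; in the
    second, 3 divides [Q] (because 3 divides [d]), which makes [y z + a Q] congruent
    to 7 modulo 12. *)
Require Import Defs.
From mathcomp Require Import all_boot all_order all_algebra.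
From mathcomp Require Import zify ring lra.
Import Order.TTheory GRing.Theory Num.Theory.
Local Open Scope ring_scope.

(* Descent replaces quadratic reciprocity: after choosing [u] even with [|u| < |n|],
   the cofactor of [n] (divided by 3 when 3 divides [u]) is smaller than [n] and
   again 5 or 7 modulo 12. *)
Lemma dvdz_sqr_sub3_mod12 (n u : int) :
  (n %| u ^+ 2 - 3)%Z -> (n %% 12)%Z != 5 /\ (n %% 12)%Z != 7.
Proof.
have [k] := ubnP `|n|%N; elim: k n u => // k IH n u lt_nk n_dvd.
suff: ~ ((n %% 12)%Z = 5 \/ (n %% 12)%Z = 7).
  by move=> nbad; split; apply/eqP => h; apply: nbad; [left | right].
move=> nmod.
have [v [w [lt_v v_dvd vE]]] : exists v w : int,
    [/\ `|v| < `|n|, (n %| v ^+ 2 - 3)%Z & v = w * 2].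
  have [c cE] := dvdzP n_dvd.
  have [q [r [rE r_ge0 r_lt]]] : exists q r : int,
      [/\ u = q * n + r, 0 <= r & r < `|n|].
    exists (u %/ n)%Z, (u %% n)%Z; split; first exact: divz_eq.
      by apply: modz_ge0; lia.
    by apply: ltz_mod; lia.
  have rnE : r ^+ 2 - 3 = (c - q * (u + r)) * n.
    by rewrite mulrBl -cE rE; ring.
  case: (boolP ((r %% 2)%Z == 0)) => r_even.
    exists r, (r %/ 2)%Z; split; [lia| |lia].
    by rewrite rnE dvdz_mull.
  (* [n] is odd, so shifting an odd remainder by [|n|] makes it even; being odd, [r] is nonzero,
     which keeps the bound strict. *)
  exists (r - `|n|), ((r - `|n|) %/ 2)%Z; split; [lia| |lia].
  have nE : `|n| = sgz n * n by lia.
  apply/dvdzP; exists (c - q * (u + r) - 2 * r * sgz n + sgz n * `|n|).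
  by rewrite mulrDl mulrBl -rnE nE; ring.
have [k' [e [nE he]]] : exists k' e : int, n = 12 * k' + e /\ (e = 5 \/ e = 7).
  exists (n %/ 12)%Z, (n %% 12)%Z; split; last exact: nmod.
  by rewrite mulrC -divz_eq.
have [g [c [wE hc]]] : exists g c : int, w = 3 * g + c /\ [\/ c = 0, c = 1 | c = 2].
  exists (w %/ 3)%Z, (w %% 3)%Z; split; first by rewrite mulrC -divz_eq.
  have : (w %% 3)%Z = 0 \/ (w %% 3)%Z = 1 \/ (w %% 3)%Z = 2 by lia.
  by case=> [|[]]; [constructor 1|constructor 2|constructor 3].
have [n_ge5 v_le] : 5 <= `|n| /\ `|v| <= `|n| - 1 by clear -nmod lt_v; lia.
(* This makes the cofactor [m] smaller than [n]: [(|n| - 1)^2 + 3 < n^2] once [|n|] exceeds 2. *)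
have lt_vn : `|v ^+ 2 - 3| < `|n| * `|n|.
  have := ler_pM (normr_ge0 v) (normr_ge0 v) v_le v_le.
  rewrite -expr2 real_normK ?num_real // mulrBl !mulrBr => v2_le.
  apply: le_lt_trans (ler_normB _ _) _; rewrite normrX real_normK ?num_real // normr_nat.
  by clear -v2_le n_ge5; lra.
have [m mE] : exists m : int, v ^+ 2 - 3 = m * n by apply/dvdzP.
have lt_mn : (`|m| < k)%N.
  move: lt_vn; rewrite mE normrM ltr_pM2r; last by clear -n_ge5; lra.
  by clear -lt_nk; lia.
have m_dvd : (m %| v ^+ 2 - 3)%Z by rewrite mE dvdz_mulr.
(* Modulo 12, [m * e] is [m * n = 4 * w ^+ 2 - 3], which depends only on [w] modulo 3. *)
have [t tE] : exists t, m * e = t * 12 + (4 * c ^+ 2 - 3).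
  exists (3 * g ^+ 2 + 2 * g * c - m * k').
  have -> : m * e = m * n - m * k' * 12 by rewrite nE; ring.
  by rewrite -mE vE wE; ring.
case: hc => cE.
(* Here [m' * e] is -1 modulo 12. Since 5 and 7 are their own inverses modulo 12, [m'] is [- e],
   again 7 or 5. *)
- have [m' m3] : exists m', m = m' * 3.
    by exists (m %/ 3)%Z; clear -he tE cE; case: he tE => ->; rewrite cE; lia.
  have [s sE] : exists s, m' * e = s * 12 - 1.
    exists (g ^+ 2 - m' * k'); apply: (@mulIf _ (3 : int)) => //.
    have -> : m' * e * 3 = m * n - m' * 3 * k' * 12 by rewrite nE m3; ring.
    by rewrite -mE vE wE cE; ring.
  have [||] := IH m' v; first by clear -lt_mn m3; lia.
    by apply: dvdz_trans m_dvd; apply/dvdzP; exists 3; rewrite mulrC.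
  by clear -he sE; case: he sE => ->; lia.
(* For [c = 1] and [c = 2] alike, [m * e] is 1 modulo 12, so [m] has the residue [e]. *)
- by have [] := IH m v lt_mn m_dvd; clear -he tE cE; case: he tE => ->; rewrite cE; lia.
- by have [] := IH m v lt_mn m_dvd; clear -he tE cE; case: he tE => ->; rewrite cE; lia.
Qed.

Lemma modz_mem_iota (n : int) (d : nat) :
  (0 < d)%N -> (n %% d)%Z \in [seq Posz i | i <- iota 0 d].
Proof.
move=> d_gt0; have := modz_ge0 n (_ : d%:Z != 0); have := @ltz_pmod n d.
case: (n %% d)%Z => [r|r] lt_rd ge0; last by have := ge0 ltac:(lia).
by rewrite map_f // mem_iota; lia.
Qed.

(** Induction in steps of two reduces this to [x^5 = x^3] modulo 12, checked on the twelve
    residues. *)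
Lemma exprz_odd_mod12 (x : int) (d : nat) :
  odd d -> (2 < d)%N -> (x ^+ d = x ^+ 3 %[mod 12])%Z.
Proof.
move=> d_odd d_gt2.
have -> : d = (3 + 2 * (d./2.-1))%N by lia.
elim: (d./2.-1) => [|m IH]; first by rewrite muln0.
have -> : (3 + 2 * m.+1 = 2 + (3 + 2 * m))%N by lia.
rewrite exprD -modzMmr IH modzMmr -exprD -modzXm -[RHS]modzXm.
move: (modz_mem_iota x 12 isT).
by move: (x %% 12)%Z => r r_in; apply/eqP; move: r r_in; apply/allP; vm_compute.
Qed.

(** This is the equation reduced modulo 12: [a] becomes 1, the exponent [d] becomes 3, and [b]
    becomes [2^3 - 3 = 5]. All residue triples are enumerated. *)
Lemma residues_mod12 (x y z : int) :
  (x ^+ 3 - y ^+ 2 - z ^+ 2 + x * y * z - 5 = 0 %[mod 12])%Z ->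
  (x %% 12)%Z = 9 \/
  [/\ (x %% 12)%Z = 5, (y %% 2)%Z = 0, (z %% 2)%Z = 0 & ((y - z) %% 3)%Z = 0].
Proof.
pose s := [seq Posz i | i <- iota 0 12].
have mod_s n : (n %% 12)%Z \in s by exact: modz_mem_iota.
pose F (x y z : int) := x ^+ 3 - y ^+ 2 - z ^+ 2 + x * y * z - 5.
have check : all (fun i => all (fun j => all (fun k =>
    ((F i j k %% 12)%Z == 0) ==> ((i == 9) || [&& i == 5, (j %% 2)%Z == 0,
      (k %% 2)%Z == 0 & ((j - k) %% 3)%Z == 0])) s) s) s.
  by vm_compute.
have F_mod : (F x y z = F (x %% 12)%Z (y %% 12)%Z (z %% 12)%Z %[mod 12])%Z.
  apply/eqP; rewrite eqz_mod_dvd; apply/dvdzP.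
  have [i [j [k [xE yE zE]]]] : exists i j k : int,
      [/\ x = i * 12 + (x %% 12)%Z, y = j * 12 + (y %% 12)%Z
        & z = k * 12 + (z %% 12)%Z].
    by exists (x %/ 12)%Z, (y %/ 12)%Z, (z %/ 12)%Z; split; exact: divz_eq.
  move: xE yE zE; move: (x %% 12)%Z (y %% 12)%Z (z %% 12)%Z => p q r -> -> ->.
  rewrite /F; exists (i * ((i * 12 + p) ^+ 2 + (i * 12 + p) * p + p ^+ 2)
    - j * (j * 12 + 2 * q) - k * (k * 12 + 2 * r)
    + i * (j * 12 + q) * (k * 12 + r) + p * j * (k * 12 + r) + p * q * k).
  by ring.
rewrite -/(F x y z) F_mod mod0z => F0.
move/allP/(_ _ (mod_s x))/allP/(_ _ (mod_s y))/allP/(_ _ (mod_s z)): check.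
rewrite F0 eqxx /= => /orP[/eqP-> | /and4P[/eqP-> /eqP hy /eqP hz /eqP hyz]].
  by left.
by right; split=> //; lia.
Qed.

Theorem theorem2p1 (d : nat) (a b : int)
    (hd0 : (0 < d)%N) (hd_odd : odd d) (hd3 : (3 %| d)%N)
    (ha : (a = 1 %[mod 12])%Z)
    (hb : b = 2 ^+ d * a - 3) :
  ~ exists x y z : int,
      a * x ^+ d - y ^+ 2 - z ^+ 2 + x * y * z - b = 0.
Proof.
move=> [x [y [z eq0]]].
have d_gt2 : (2 < d)%N by lia.
have powE (n : int) : exists q, n ^+ d = q * 12 + n ^+ 3.
  have /eqP := exprz_odd_mod12 n d hd_odd d_gt2.
  by rewrite eqz_mod_dvd => /dvdzP[q hq]; exists q; rewrite -hq subrK.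
have [X XE] := powE x; have [T TE] := powE 2.
have [A AE] : exists A, a = A * 12 + 1 by exists (a %/ 12)%Z; lia.
have F0 : (x ^+ 3 - y ^+ 2 - z ^+ 2 + x * y * z - 5 = 0 %[mod 12])%Z.
  apply/eqP; rewrite eqz_mod_dvd subr0; apply/dvdzP.
  exists (T * a + 8 * A - 1 - X * a - A * x ^+ 3 + 1).
  apply/eqP; rewrite -subr_eq0 -[X in _ == X]eq0 hb XE TE AE; apply/eqP; ring.
pose e := (d %/ 3)%N.
have dE : d = (e * 3)%N by lia.
have [R RE] : exists R, x ^+ e - 2 ^+ e = (x - 2) * R.
  by eexists; exact: subrXX.
pose Q := R * ((x ^+ e) ^+ 2 + x ^+ e * 2 ^+ e + (2 ^+ e) ^+ 2).
have QE : x ^+ d - 2 ^+ d = (x - 2) * Q.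
  by rewrite dE !exprM /Q mulrA -RE; ring.
have factor : (y - z) ^+ 2 - 3 = (x - 2) * (y * z + a * Q).
  transitivity (a * (x ^+ d - 2 ^+ d) + (x - 2) * y * z); last by rewrite QE; ring.
  by apply/eqP; rewrite -subr_eq0 -oppr_eq0 -[X in _ == X]eq0 hb; apply/eqP; ring.
have [x9 | [x5 y0 z0 yz]] := residues_mod12 x y z F0.
  have t_dvd : (x - 2 %| (y - z) ^+ 2 - 3)%Z by rewrite factor dvdz_mulr.
  by have [_ /eqP[]] := dvdz_sqr_sub3_mod12 (x - 2) (y - z) t_dvd; clear -x9; lia.
have [k xE] : exists k, x = k * 12 + 5 by exists (x %/ 12)%Z; clear -x5; lia.
have [j yE] : exists j, y = j * 2 by exists (y %/ 2)%Z; clear -y0; lia.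
have [w zE] : exists w, z = y - w * 6 by exists ((y - z) %/ 6)%Z; clear -y0 z0 yz; lia.
(* With [X = x ^+ e] and [Y = 2 ^+ e], [X^2 + X Y + Y^2 = (X - Y)^2 + 3 X Y], and 3 divides [X - Y]
   because [x - 2 = 3 * (4 * k + 1)]. *)
have [q qE] : exists q, Q = q * 3.
  exists (R * ((4 * k + 1) * R * (x ^+ e - 2 ^+ e) + x ^+ e * 2 ^+ e)).
  have -> : Q = R * ((x ^+ e - 2 ^+ e) * (x ^+ e - 2 ^+ e) + 3 * (x ^+ e * 2 ^+ e)).
    by rewrite /Q; ring.
  by rewrite {1}RE {1}xE; ring.
pose S := y * z + a * Q.
have S_dvd : (S %| (y - z) ^+ 2 - 3)%Z by rewrite factor dvdz_mull.
have [_ /eqP[]] := dvdz_sqr_sub3_mod12 S (y - z) S_dvd.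
(* The factorization divided by 3. It gives [S = 3] modulo 4 and shows that 3 does not divide
   [S]. *)
have S_norm : S + 4 * (k * S) = 12 * w ^+ 2 - 1.
  apply: (@mulIf _ (3 : int)) => //.
  transitivity ((y - z) ^+ 2 - 3); first by rewrite factor -/S xE; ring.
  by rewrite zE; ring.
(* Modulo 3, [S] is [y * z], hence the square [j ^+ 2]; being nonzero it is 1, and with 3 modulo 4
   this gives 7 modulo 12. *)
have [c [i [cE SE]]] : exists c i : int,
    [\/ c = 0, c = 1 | c = 2] /\ S = c ^+ 2 + i * 3.
  exists (j %% 3)%Z; set c := (j %% 3)%Z; set p := (j %/ 3)%Z.
  have jE : j = p * 3 + c by exact: divz_eq.
  exists (j ^+ 2 + p * (j + c) - 4 * j * w + a * q); split.
    have : c = 0 \/ c = 1 \/ c = 2 by clear; lia.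
    by case=> [|[]]; [constructor 1|constructor 2|constructor 3].
  by rewrite /S zE yE qE jE; ring.
clear -S_norm cE SE; clearbody S.
by case: cE SE => -> SE; move: S_norm; rewrite SE; lia.
Qed.
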